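(* Let $H$ be a prime graph for which there exists an $H$-induced-saturated graph $G$. Then $G \star G$ is $H$-induced-saturated, and there is a prime graph $G'$ such that $G'$ is $H$-induced-saturated.
   Context: All graphs are finite and simple. For graphs $H,G$, write $H \subseteq_I G$ if $G$ contains an induced subgraph isomorphic to $H$. A graph $G$ is $H$-induced-saturated if $H \not\subseteq_I G$, but $H \subseteq_I G - e$ for every edge $e \in E(G)$ and $H \subseteq_I G + e$ for every edge $e \in E(\overline{G})$ of the complement. A homogeneous set of an $n$-vertex graph $G$ is a set $X \subsetneq V(G)$ with $2 \leq |X| \leq n-1$ such that every vertex $v \in V(G)\setminus X$ satisfies $X \subseteq N(v)$ or $X \cap N(v)=\emptyset$. A graph is prime if it has no homogeneous set. For graphs $G_1=(V_1,E_1)$ and $G_2=(V_2,E_2)$, the blowup product $G_1 \star G_2$ is the graph on vertex set $V_1\times V_2$ in which $(u_1,v_1)$ and $(u_2,v_2)$ are adjacent iff either $u_1u_2 \in E_1$, or $u_1=u_2$ and $v_1v_2 \in E_2$. *)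

(* Defs.v *)
From HB Require Import structures.
From mathcomp Require Import all_boot.

Set Implicit Arguments.
Unset Strict Implicit.
Unset Printing Implicit Defensive.

Record sgraph := SGraph {
  vertex :> finType;
  edge : rel vertex;
  edge_sym : symmetric edge;
  edge_irrefl : irreflexive edge }.

Definition isomorphic (H G : sgraph) : Prop :=
  exists2 f : H -> G, bijective f & forall x y, edge (f x) (f y) = edge x y.

Section Operations.
Variable G : sgraph.

Definition neighbours (v : G) : {set G} := [set u | edge v u].

Section Induced.
Variable S : {set G}.
Definition induced_edge : rel {x : G | x \in S} :=
  fun x y => edge (val x) (val y).
Fact induced_edge_sym : symmetric induced_edge.
Proof. by move=> x y; apply: edge_sym. Qed.
Fact induced_edge_irrefl : irreflexive induced_edge.
Proof. by move=> x; apply: edge_irrefl. Qed.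
Definition induced : sgraph := SGraph induced_edge_sym induced_edge_irrefl.
End Induced.

Definition compl_edge : rel G := fun x y => (x != y) && ~~ edge x y.
Fact compl_edge_sym : symmetric compl_edge.
Proof. by move=> x y; rewrite /compl_edge eq_sym edge_sym. Qed.
Fact compl_edge_irrefl : irreflexive compl_edge.
Proof. by move=> x; rewrite /compl_edge eqxx. Qed.
Definition compl : sgraph := SGraph compl_edge_sym compl_edge_irrefl.

Section OneEdge.
Variables a b : G.

Definition del_edge_rel : rel G :=
  fun x y => edge x y && ([set x; y] != [set a; b]).
Fact del_edge_sym : symmetric del_edge_rel.
Proof. by move=> x y; rewrite /del_edge_rel edge_sym setUC. Qed.
Fact del_edge_irrefl : irreflexive del_edge_rel.
Proof. by move=> x; rewrite /del_edge_rel edge_irrefl. Qed.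
Definition del_edge : sgraph := SGraph del_edge_sym del_edge_irrefl.

(* The conjunct [x != y] only matters when [a = b], where nothing is added;
   it lets [add_edge] be total. *)
Definition add_edge_rel : rel G :=
  fun x y => edge x y || (x != y) && ([set x; y] == [set a; b]).
Fact add_edge_sym : symmetric add_edge_rel.
Proof. by move=> x y; rewrite /add_edge_rel edge_sym eq_sym setUC. Qed.
Fact add_edge_irrefl : irreflexive add_edge_rel.
Proof. by move=> x; rewrite /add_edge_rel edge_irrefl eqxx. Qed.
Definition add_edge : sgraph := SGraph add_edge_sym add_edge_irrefl.
End OneEdge.

Definition homogeneous (X : {set G}) : Prop :=
  1 < #|X| < #|G| /\
  forall v : G, v \notin X ->
    X \subset neighbours v \/ X :&: neighbours v = set0.

Definition prime_graph : Prop := forall X : {set G}, ~ homogeneous X.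

End Operations.

Definition induced_subgraph (H G : sgraph) : Prop :=
  exists S : {set G}, isomorphic H (induced S).

(* Any graph with at most one vertex that does not contain H qualifies
   vacuously. *)
Definition induced_saturated (H G : sgraph) : Prop :=
  [/\ ~ induced_subgraph H G,
      forall x y : G, edge x y -> induced_subgraph H (del_edge x y)
    & forall x y : G, @edge (compl G) x y -> induced_subgraph H (add_edge x y)].

Section Blowup.
Variables G1 G2 : sgraph.
Definition blowup_edge : rel (G1 * G2)%type :=
  fun p q => edge p.1 q.1 || (p.1 == q.1) && edge p.2 q.2.
Fact blowup_edge_sym : symmetric blowup_edge.
Proof.
by move=> p q; rewrite /blowup_edge edge_sym eq_sym [edge p.2 _]edge_sym.
Qed.
Fact blowup_edge_irrefl : irreflexive blowup_edge.
Proof. by move=> p; rewrite /blowup_edge !edge_irrefl andbF. Qed.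
Definition blowup : sgraph := SGraph blowup_edge_sym blowup_edge_irrefl.
End Blowup.

(* Main.v *)
(** A copy of the prime graph [H] meets a module of the host graph (a vertex set
    no outside vertex of which distinguishes two members) in at most one vertex,
    or lies inside it.  The fibres of the first projection of the blowup are
    modules, so a copy of [H] in the blowup would live in one fibre or in a
    transversal of the fibres, hence in [G]; conversely every pair of vertices
    of the blowup lies in a copy of [G] of one of these two kinds.  For the
    prime graph: if [X] is homogeneous in [G], changing one pair inside [X]
    creates a copy of [H] that uses this pair and thus lies inside [X], so the
    smaller graph induced on [X] is again [H]-induced-saturated. *)
Require Import Defs.
From HB Require Import structures.
From mathcomp Require Import all_boot.

Set Implicit Arguments.
Unset Strict Implicit.
Unset Printing Implicit Defensive.

(** * Embeddings and changes of a single pair *)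

Definition embedding (H G : sgraph) (f : H -> G) : Prop :=
  injective f /\ {mono f : x y / edge x y}.

Lemma induced_subgraphP (H G : sgraph) :
  induced_subgraph H G <-> exists f : H -> G, embedding f.
Proof.
split=> [[S [f bij_f edge_f]] | [f [inj_f edge_f]]].
  exists (val \o f); split=> [|x y]; last exact: edge_f.
  exact: inj_comp val_inj (bij_inj bij_f).
have im x : f x \in f @: [set: H] by rewrite imset_f.
exists (f @: [set: H]), (fun x => Sub (f x) (im x) : induced _).
  apply: inj_card_bij => [x y /(congr1 val) /inj_f // |].
  by rewrite card_sig card_imset // cardsT.
by move=> x y; apply: edge_f.
Qed.

Lemma embedding_comp (H G K : sgraph) (g : G -> K) (f : H -> G) :
  embedding g -> embedding f -> embedding (g \o f).
Proof.
move=> [inj_g edge_g] [inj_f edge_f]; split; first exact: inj_comp.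
by move=> x y /=; rewrite edge_g edge_f.
Qed.

Lemma eq_set2_inj (T U : finType) (g : T -> U) (x y a b : T) :
  injective g -> ([set g x; g y] == [set g a; g b]) = ([set x; y] == [set a; b]).
Proof.
by move=> inj_g; rewrite -(inj_eq (imset_inj inj_g)) !imsetU1 !imset_set1.
Qed.

(** An injection preserves equality of unordered pairs, so a copy of [G] in [K] stays a copy after
    the corresponding pair is changed in both. *)
Lemma del_edge_embedding (G K : sgraph) (g : G -> K) (a b : G) :
  embedding g -> @embedding (del_edge a b) (del_edge (g a) (g b)) g.
Proof.
move=> [inj_g edge_g]; split=> // x y.
by rewrite /edge /= /del_edge_rel edge_g eq_set2_inj.
Qed.

Lemma add_edge_embedding (G K : sgraph) (g : G -> K) (a b : G) :
  embedding g -> @embedding (add_edge a b) (add_edge (g a) (g b)) g.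
Proof.
move=> [inj_g edge_g]; split=> // x y.
by rewrite /edge /= /add_edge_rel edge_g eq_set2_inj // (inj_eq inj_g).
Qed.

(** * Modules and prime graphs *)

Definition graph_module (G : sgraph) (X : {set G}) : Prop :=
  forall v x y, v \notin X -> x \in X -> y \in X -> edge v x = edge v y.

Lemma homogeneousP (G : sgraph) (X : {set G}) :
  homogeneous X <-> 1 < #|X| < #|G| /\ graph_module X.
Proof.
split=> -[cardX modX]; split=> // v.
  move=> x y /modX [/subsetP sub | dis] Xx Xy.
    by move: (sub x Xx) (sub y Xy); rewrite !inE => -> ->.
  have no z : z \in X -> edge v z = false.
    by move=> Xz; move/setP/(_ z): dis; rewrite !inE Xz.
  by rewrite !no.
move=> Xv; have [z Xz] : exists z, z \in X.
  by apply/card_gt0P; case/andP: cardX => /ltnW.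
case Evz: (edge v z); [left | right].
  by apply/subsetP => x Xx; rewrite inE (modX v x z).
apply/setP => x; rewrite !inE; case Xx: (x \in X) => //=.
by rewrite (modX v x z).
Qed.

(** The preimage of a module under an embedding is a module of [H]; containing [x] and [y] but
    missing some [z], it would be homogeneous. *)
Lemma prime_embedding_module (H G : sgraph) (f : H -> G) (X : {set G}) (x y : H) :
  prime_graph H -> embedding f -> graph_module X ->
  x != y -> f x \in X -> f y \in X -> forall z, f z \in X.
Proof.
move=> primeH [_ edge_f] modX xy Xx Xy z; apply/negPn/negP => Xz.
apply: (primeH (f @^-1: X)); apply/homogeneousP; split.
  apply/andP; split.
    by apply/card_gt1P; exists x, y; rewrite !inE.
  by rewrite -cardsT proper_card // properT; apply/eqP => /setP/(_ z);
    rewrite !inE (negPf Xz).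
move=> v u w; rewrite !inE => Xv Xu Xw.
by rewrite -!edge_f; apply: modX.
Qed.

(** * Copies inside the blowup *)

Section BlowupCopies.
Variable G : sgraph.
Local Notation GG := (blowup G G).

Lemma blowup_fibre_embedding (u : G) : @embedding G GG (pair u).
Proof.
split=> [x y [] // | x y].
by rewrite /edge /= /blowup_edge /= edge_irrefl eqxx.
Qed.

Lemma blowup_section_embedding (g : G -> GG) :
  (forall u, (g u).1 = u) -> embedding g.
Proof.
move=> gK; split=> [|u v]; first exact: (can_inj gK).
rewrite {1}/edge /= /blowup_edge !gK.
by case: eqP => [-> | _]; rewrite ?edge_irrefl ?orbF.
Qed.

Lemma blowup_pair_embedding (p q : GG) :
  exists (g : G -> GG) (a b : G),
    [/\ embedding g, g a = p & g b = q].
Proof.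
case: p q => [u v] [u' v']; have [-> | uu'] := eqVneq u u'.
  by exists (pair u'), v, v'; split=> //; apply: blowup_fibre_embedding.
(* A transversal of the fibres through both given vertices: height [v] over [u], and [v'] over every
   other vertex. *)
exists (fun w => (w, if w == u then v else v') : GG), u, u'; split.
- exact: blowup_section_embedding.
- by rewrite eqxx.
- by rewrite eq_sym (negPf uu').
Qed.

Lemma blowup_fibre_module (u : G) : @graph_module GG [set p | p.1 == u].
Proof.
move=> p q r; rewrite !inE => pu /eqP qu /eqP ru.
by rewrite /edge /= /blowup_edge qu ru (negPf pu).
Qed.

Lemma prime_induced_blowup (H : sgraph) :
  prime_graph H -> induced_subgraph H GG -> induced_subgraph H G.
Proof.
move=> primeH /induced_subgraphP [f emb_f]; have [inj_f edge_f] := emb_f.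
apply/induced_subgraphP.
(* If the copy meets each fibre at most once, the first projection embeds it in [G]. Otherwise it
   lies in one fibre, and the second projection does. *)
case: (boolP (injectiveb (fun x => (f x).1))) => [/injectiveP inj1 | ].
  exists (fun x => (f x).1); split=> // x y.
  rewrite -edge_f {2}/edge /= /blowup_edge (inj_eq inj1).
  by case: eqP => [-> | _]; rewrite ?edge_irrefl ?orbF.
case/injectivePn=> x [y xy fxy].
have fib z : (f z).1 = (f y).1.
  have := prime_embedding_module primeH emb_f
            (@blowup_fibre_module (f y).1) xy.
  by rewrite !inE fxy eqxx => /(_ isT isT z); rewrite inE => /eqP.
exists (fun x => (f x).2); split=> z w.
  by move=> eq2; apply: inj_f; rewrite [LHS]surjective_pairing fib eq2 -(fib w)
    -surjective_pairing.
by rewrite -edge_f {2}/edge /= /blowup_edge !fib edge_irrefl eqxx.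
Qed.

End BlowupCopies.

Lemma induced_saturated_blowup (H G : sgraph) :
  prime_graph H -> induced_saturated H G -> induced_saturated H (blowup G G).
Proof.
move=> primeH [noH delH addH]; split.
- by move/(prime_induced_blowup primeH).
- move=> p q; have [g [a [b [emb_g <- <-]]]] := blowup_pair_embedding p q.
  have [_ ->] := emb_g => /delH/induced_subgraphP [f emb_f].
  apply/induced_subgraphP; exists (g \o f).
  exact: embedding_comp (del_edge_embedding _ _ emb_g) emb_f.
- move=> p q; have [g [a [b [emb_g <- <-]]]] := blowup_pair_embedding p q.
  have [inj_g edge_g] := emb_g.
  rewrite /edge /= /compl_edge edge_g (inj_eq inj_g).
  move=> /(addH a b)/induced_subgraphP [f emb_f].
  apply/induced_subgraphP; exists (g \o f).
  exact: embedding_comp (add_edge_embedding _ _ emb_g) emb_f.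
Qed.

(** * Restricting saturation to a module *)

Section HomogeneousSubgraph.
Variables (H G : sgraph) (X : {set G}).
Hypotheses (primeH : prime_graph H) (modX : graph_module X).
Hypothesis noH : ~ induced_subgraph H G.

Lemma val_embedding : @embedding (induced X) G val.
Proof. by split=> //; apply: val_inj. Qed.

(** The relation [e] stands for [G] with the pair [a], [b] possibly altered, which treats deletion
    and addition at once. *)
Lemma changed_pair_copy_in_module (e : rel G) (a b : G) (f : H -> G) :
  (forall x y, [set x; y] != [set a; b] -> e x y = edge x y) ->
  symmetric e -> irreflexive e -> a \in X -> b \in X -> a != b ->
  injective f -> {mono f : x y / edge x y >-> e x y} ->
  forall z, f z \in X.
Proof.
move=> e_eq e_sym e_irr Xa Xb ab inj_f edge_f.
(* A copy avoiding [a] or [b] never sees the changed pair, so it would already be a copy in [G]. *)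
have hit c : c \in [set a; b] -> exists x, f x = c.
  move=> abc; case: (boolP (c \in codom f)) => [/codomP [x ->] | cN].
    by exists x.
  case: noH; apply/induced_subgraphP; exists f; split=> // x y.
  rewrite -edge_f e_eq //; apply: contraNneq cN => fxy.
  by move: abc; rewrite -fxy !inE => /orP [] /eqP ->; apply: codom_f.
have [x fx] := hit a (set21 a b); have [y fy] := hit b (set22 a b).
(* The changed pair lies inside [X], so adjacency between [X] and its outside is untouched. *)
have mod_e : @graph_module (SGraph e_sym e_irr) X.
  have ne v c : v \notin X -> [set v; c] != [set a; b].
    apply: contraNneq => eq_vc; have := set21 v c.
    by rewrite eq_vc !inE => /orP [] /eqP ->.
  by move=> v c d Xv Xc Xd; rewrite /edge /= !e_eq ?ne //; apply: modX.
apply: (@prime_embedding_module H (SGraph e_sym e_irr) f X x y) => //.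
- by apply: contraNneq ab => xy; rewrite -fx -fy xy.
- by rewrite fx.
- by rewrite fy.
Qed.

Lemma induced_saturated_module :
  induced_saturated H G -> induced_saturated H (induced X).
Proof.
move=> [_ delH addH]; split.
- move=> /induced_subgraphP [f emb_f]; apply: noH; apply/induced_subgraphP.
  by exists (val \o f); apply: embedding_comp val_embedding emb_f.
- move=> a b Eab; have ab : val a != val b.
    by apply: contraTneq Eab => /val_inj ->; rewrite edge_irrefl.
  have /induced_subgraphP [f [inj_f edge_f]] := delH _ _ Eab.
  have inX : forall z, f z \in X.
    apply: (@changed_pair_copy_in_module (del_edge_rel (val a) (val b))
              (val a) (val b)) => //; try exact: valP.
    + by move=> x y ne; rewrite /del_edge_rel ne andbT.
    + exact: del_edge_sym.
    + exact: del_edge_irrefl.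
  apply/induced_subgraphP.
  (* The copy lies in [X], hence factors through [val], which also embeds the changed [induced X] in
     the changed [G]. *)
  exists (fun z => Sub (f z) (inX z) : induced X); split.
    by move=> x y /(congr1 val) /inj_f.
  move=> x y; rewrite -edge_f.
  by have [_ <-] := del_edge_embedding a b val_embedding.
- move=> a b Nab; have /andP [ab _] := Nab.
  have /induced_subgraphP [f [inj_f edge_f]] := addH (val a) (val b) Nab.
  have inX : forall z, f z \in X.
    apply: (@changed_pair_copy_in_module (add_edge_rel (val a) (val b))
              (val a) (val b)) => //; try exact: valP.
    + by move=> x y ne; rewrite /add_edge_rel (negPf ne) andbF orbF.
    + exact: add_edge_sym.
    + exact: add_edge_irrefl.
  apply/induced_subgraphP.
  exists (fun z => Sub (f z) (inX z) : induced X); split.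
    by move=> x y /(congr1 val) /inj_f.
  move=> x y; rewrite -edge_f.
  by have [_ <-] := add_edge_embedding a b val_embedding.
Qed.

End HomogeneousSubgraph.

(** * Descent to a prime saturated graph *)

(** Homogeneity is decidable on a finite graph, so a search over all vertex sets settles the
    alternative constructively. *)
Lemma prime_or_homogeneous (G : sgraph) :
  prime_graph G \/ exists X : {set G}, homogeneous X.
Proof.
pose homb (X : {set G}) := (1 < #|X| < #|G|) &&
  [forall v, (v \notin X) ==>
    ((X \subset neighbours v) || (X :&: neighbours v == set0))].
have hombP X : reflect (homogeneous X) (homb X).
  apply: (iffP andP) => -[cardX modX]; split=> //.
    move=> v Xv; have /implyP/(_ Xv)/orP [] := forallP modX v; first by left.
    by move/eqP; right.
  apply/forallP => v; apply/implyP => /modX [-> // | ->].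
  by rewrite eqxx orbT.
case: (pickP homb) => [X /hombP homX | no]; first by right; exists X.
by left=> X /hombP; rewrite no.
Qed.

(** Strong induction on the number of vertices. The last conjunct rules out a collapse to a trivial
    graph: it survives each step because a homogeneous set has at least two vertices. *)
Lemma prime_induced_saturated (H G : sgraph) :
  prime_graph H -> induced_saturated H G ->
  exists G' : sgraph,
    [/\ prime_graph G', induced_saturated H G' & 1 < #|G| -> 1 < #|G'|].
Proof.
move=> primeH; have [n] := ubnP #|G|; elim: n G => // n IHn G ltGn satG.
have [primeG | [X /homogeneousP [/andP [X_gt1 ltXG] modX]]] :=
  prime_or_homogeneous G; first by exists G.
have cardX : #|induced X| = #|X| by rewrite card_sig; apply: eq_card.
have [||G' [primeG' satG' gt1]] := IHn (induced X).
- by rewrite cardX (leq_trans ltXG).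
- by apply: induced_saturated_module => //; case: satG.
by exists G'; split=> // _; apply: gt1; rewrite cardX.
Qed.

Theorem theorem20 (H G : sgraph) (primeH : prime_graph H)
    (satG : induced_saturated H G) :
  induced_saturated H (blowup G G) /\
  exists G' : sgraph,
    [/\ prime_graph G', induced_saturated H G' & 1 < #|G| -> 1 < #|G'|].
Proof.
split; first exact: induced_saturated_blowup.
exact: prime_induced_saturated.
Qed.
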